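(* Let $2\le n<m$ be integers, $S=\Gamma_m(n)$, $S_1=\Gamma_m(1)$, and $Q_1=\mathbb{K}[x_0,x_2,\ldots,x_{m-1}]$. Let $I_S\subset Q$ and $I_{S_1}\subset Q_1$ be the defining toric ideals. Then for each $1\le d\le m-3$, $$\beta_d(Q/I_S)=\beta_d(Q_1/I_{S_1})+\binom{m-n}{d+1-n},$$ and $\beta_{m-2}(Q/I_S)=m-n$.
   Context: $\mathbb{K}$ is a field. For $1\le n<m$, $\Gamma_m(n)$ is the numerical semigroup generated by $\{m,m+1,\ldots,2m-1\}\setminus\{m+n\}$. For $2\le n<m$, $Q=\mathbb{K}[x_i\mid 0\le i\le m-1,\ i\ne n]$ and $I_S$ is the kernel of $Q\to\mathbb{K}[t]$, $x_i\mapsto t^{m+i}$; similarly $I_{S_1}$ is the kernel of $Q_1\to\mathbb{K}[t]$, $x_i\mapsto t^{m+i}$. $\beta_d(Q/I)=\dim_{\mathbb{K}}\operatorname{Tor}_d^Q(Q/I,\mathbb{K})$, with $\mathbb{K}$ the quotient of the polynomial ring by the ideal of all variables. Binomial coefficients $\binom ab$ (with $a\ge0$) are zero when $b<0$ or $b>a$. *)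

(* Defs.v *)
From Stdlib Require Import ClassicalEpsilon.
From HB Require Import structures.
From mathcomp Require Import all_boot all_order all_algebra.
From mathcomp Require Import mpoly.

Set Implicit Arguments.
Unset Strict Implicit.
Unset Printing Implicit Defensive.

Import GRing.Theory.
Local Open Scope ring_scope.

(* Elements of R^r are row vectors; dif i acts by right multiplication
   R^(rk i.+1) -> R^(rk i). *)
Record free_complex (R : nzRingType) := FreeComplex {
  rk : nat -> nat;
  dif : forall i : nat, 'M[R]_(rk i.+1, rk i)
}.

(* F is a resolution of R/I: since R^(rk F 0) is free, every R-linear map
   R^(rk F 0) -> R/I is v |-> v *m e modulo I for some column e. *)
Definition is_free_resolution (R : nzRingType) (I : R -> Prop)
    (F : free_complex R) : Prop :=
  exists e : 'cV[R]_(rk F 0),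
    [/\ forall q : R, exists v : 'rV[R]_(rk F 0), I ((v *m e) 0 0 - q),
        forall v : 'rV[R]_(rk F 0),
          I ((v *m e) 0 0) <-> exists w, v = w *m dif F 0
      & forall (i : nat) (v : 'rV[R]_(rk F i.+1)),
          v *m dif F i = 0 <-> exists w, v = w *m dif F i.+1].

Section Betti.

Variables (K : fieldType) (k : nat).
Local Notation Q := {mpoly K[k]}.

(* The differential of F (x)_Q K, where K = Q/(all variables): the quotient
   map Q -> K is evaluation at the origin. *)
Definition dif_at0 (F : free_complex Q) (i : nat) :
    'M[K]_(rk F i.+1, rk F i) :=
  map_mx (meval (fun _ : 'I_k => 0)) (dif F i).

(* Dimension of ker / im in degree d of F (x)_Q K. *)
Definition dim_homology_at0 (F : free_complex Q) (d : nat) : nat :=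
  match d with
  | 0 => rk F 0 - \rank (dif_at0 F 0)
  | d'.+1 => \rank (kermx (dif_at0 F d')) - \rank (dif_at0 F d'.+1)
  end%N.

(* dim_K Tor_d^Q(Q/I, K), computed from a resolution of Q/I by free modules of
   finite rank: one exists as Q is Noetherian, and the value does not depend
   on it. *)
Definition betti (I : Q -> Prop) (d : nat) : nat :=
  epsilon (inhabits 0%N)
    (fun b : nat =>
       exists2 F, is_free_resolution I F & dim_homology_at0 F d = b).

(* Kernel of the K-algebra map K[x_j | j < k] -> K[t], x_j |-> t^(a j). *)
Definition toric_ideal (a : 'I_k -> nat) (p : Q) : Prop :=
  mmap (@polyC K) (fun j : 'I_k => 'X^(a j)) p = 0.

End Betti.

Arguments toric_ideal K {k} a p.

(* bump n enumerates the naturals other than n in increasing order, so for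
   n < m the j-th variable of K[x_i | 0 <= i <= m-1, i <> n] is x_(bump n j). *)
Definition Gamma_gen (m n : nat) (j : 'I_m.-1) : nat := (m + bump n j)%N.
Arguments Gamma_gen m n j : clear implicits.

Lemma Gamma_genP (m n g : nat) : (n < m)%N ->
  (exists j : 'I_m.-1, Gamma_gen m n j = g) <->
  (m <= g <= (2 * m).-1)%N /\ g <> (m + n)%N.
Proof.
move=> ltnm; split=> [[j <-]|[/andP[le_mg le_gm] /eqP neq_g]].
  split; last by move/addnI/eqP; rewrite eq_sym (negPf (neq_bump n j)).
  have ltj : (bump n j < m)%N.
    by rewrite /bump (leq_ltn_trans (leq_add (leq_b1 _) (leqnn j))) //
               add1n -ltn_predRL ltn_ord.
  rewrite /Gamma_gen leq_addr /= -ltnS prednK; last first.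
    by rewrite muln_gt0 (leq_ltn_trans _ ltnm).
  by rewrite mul2n -addnn ltn_add2l.
have m_gt0 : (0 < m)%N by apply: leq_ltn_trans ltnm.
have ltg : (g - m < m)%N.
  rewrite ltn_subLR // addnn -mul2n -[X in (_ < X)%N]prednK ?ltnS //.
  by rewrite muln_gt0.
have neqn : n != (g - m)%N.
  by apply: contraNneq neq_g => ->; rewrite subnKC.
have [j Ej _] := unlift_some (n := m) (h := Ordinal ltnm) (i := Ordinal ltg) neqn.
exists j; rewrite /Gamma_gen.
by have /= <- := congr1 val Ej; rewrite subnKC.
Qed.

(* Main.v *)
(* Write m = N + 2.  The semigroup algebra K[S] is free of rank m over K[x_0],
   on the powers of t given by the Apery set of S, so K[S] is a quotient of the
   free Q-module Q^m on which the remaining N variables act in two ways: by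
   scalars x_i and by the matrices X_i of multiplication by t^(g_i).  The
   operators x_i - X_i commute, and synthetic division by x_i - X_i contracts
   their Koszul complex, which is therefore a free resolution of K[S], of rank
   m * 'C(N, d) in degree d.  Modulo the variables it becomes the Koszul complex
   of the graded algebra A = K[S]/(t^m), with Hilbert function (1, N, 1) and a
   multiplication A_1 x A_1 -> A_2 given by a partial matching of the variables
   that covers a set R of them.  Its differential in degree d is sparse enough
   to read off the rank 'C(N, d+1) + 'C(N, d) - #{I : #|I| = d, R <= I}.  Here
   #|R| = n - 1 if n >= 2, and #|R| = N if n = 1; Pascal's rule gives the
   result. *)
Require Import Defs.
From HB Require Import structures.
From mathcomp Require Import all_boot all_order all_algebra.
From mathcomp Require Import mpoly zify.
From Stdlib Require Import ClassicalEpsilon.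

Set Implicit Arguments.
Unset Strict Implicit.
Unset Printing Implicit Defensive.

Import GRing.Theory.

(** * Comparison of free resolutions up to homotopy *)

Section Comparison.

Local Open Scope ring_scope.

Lemma row_lift (R : nzRingType) (p q r : nat) (A : 'M[R]_(p, q))
    (B : 'M[R]_(r, q)) :
  (forall v : 'rV_p, exists w : 'rV_r, v *m A = w *m B) ->
  exists C : 'M_(p, r), A = C *m B.
Proof.
move=> AB; have /fin_all_exists[w wP] i := AB (delta_mx 0 i).
exists (\matrix_i w i); apply/row_matrixP => i.
by rewrite row_mul rowK -wP -rowE.
Qed.

Variables (R : nzRingType) (I : R -> Prop).
Hypothesis ideal_add : forall a b, I a -> I b -> I (a + b).
Hypothesis ideal_mul : forall c a, I a -> I (c * a).

Lemma resolution_lift (F : free_complex R) (i p : nat)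
    (A : 'M_(p, rk F i.+1)) :
  is_free_resolution I F -> A *m dif F i = 0 ->
  exists C, A = C *m dif F i.+1.
Proof.
case=> e [_ _ exF] A0; apply: row_lift => v.
by apply/exF; rewrite -mulmxA A0 mulmx0.
Qed.

Lemma ideal_opp a : I a -> I (- a).
Proof. by rewrite -mulN1r; apply: ideal_mul. Qed.

Lemma resolution_ideal0 (F : free_complex R) : is_free_resolution I F -> I 0.
Proof.
case=> e [_ ex0 _]; have := ex0 0; rewrite mul0mx mxE => -[_]; apply.
by exists 0; rewrite mul0mx.
Qed.

Lemma augmentation_lift (F G : free_complex R) (eF : 'cV_(rk F 0))
    (eG : 'cV_(rk G 0)) :
  I 0 -> (forall q, exists v : 'rV_(rk G 0), I ((v *m eG) 0 0 - q)) ->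
  exists f : 'M_(rk F 0, rk G 0),
    forall v : 'rV_(rk F 0), I ((v *m f *m eG) 0 0 - (v *m eF) 0 0).
Proof.
move=> I0 surG; have /fin_all_exists[w wP] i := surG (eF i 0).
exists (\matrix_i w i) => v.
have -> : (v *m (\matrix_i w i) *m eG) 0 0 - (v *m eF) 0 0
    = \sum_i v 0 i * ((w i *m eG) 0 0 - eF i 0).
  rewrite -mulmxA !mxE -sumrB; apply: eq_bigr => i _.
  by rewrite -mulrBr -[w i](rowK w) -row_mul !mxE.
by elim/big_ind: _ => // i _; apply: ideal_mul; apply: wP.
Qed.

Lemma resolution_chain_map0 (F G : free_complex R) (eF : 'cV_(rk F 0))
    (eG : 'cV_(rk G 0)) (f : 'M_(rk F 0, rk G 0)) :
  (forall v : 'rV_(rk F 0), I ((v *m eF) 0 0) <-> exists w, v = w *m dif F 0) ->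
  (forall v : 'rV_(rk G 0), I ((v *m eG) 0 0) <-> exists w, v = w *m dif G 0) ->
  (forall v : 'rV_(rk F 0), I ((v *m f *m eG) 0 0 - (v *m eF) 0 0)) ->
  exists f1, dif F 0 *m f = f1 *m dif G 0.
Proof.
move=> exF exG fP; apply: row_lift => v; apply/exG.
have /exF vI : exists w, v *m dif F 0 = w *m dif F 0 by exists v.
by have := ideal_add (fP (v *m dif F 0)) vI; rewrite subrK mulmxA.
Qed.

Lemma resolution_dd0 (F : free_complex R) (i : nat) :
  is_free_resolution I F -> dif F i.+1 *m dif F i = 0.
Proof.
case=> e [_ _ exF]; apply/row_matrixP => j.
by rewrite row_mul row0; apply/exF; exists (delta_mx 0 j); rewrite -rowE.
Qed.

(* The hypothesis on h says that it is a homotopy from f g to the identity only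
   up to the kernel of left multiplication by dif F d; this is all that is
   needed to extend the homotopy one degree further. *)
Lemma comparison_step (F G : free_complex R) (d : nat)
    (f : 'M_(rk F d, rk G d)) (f' : 'M_(rk F d.+1, rk G d.+1))
    (g : 'M_(rk G d, rk F d)) (g' : 'M_(rk G d.+1, rk F d.+1))
    (h : 'M_(rk F d, rk F d.+1)) :
  is_free_resolution I F -> is_free_resolution I G ->
  dif F d *m f = f' *m dif G d -> dif G d *m g = g' *m dif F d ->
  dif F d *m (1%:M - f *m g - h *m dif F d) = 0 ->
  exists f2 g2 h',
    [/\ dif F d.+1 *m f' = f2 *m dif G d.+1,
        dif G d.+1 *m g' = g2 *m dif F d.+1
      & 1%:M - f' *m g' - dif F d *m h = h' *m dif F d.+1].
Proof.
move=> resF resG ff' gg' hP.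
have [|f2 f2P] := resolution_lift (A := dif F d.+1 *m f') resG.
  by rewrite -mulmxA -ff' mulmxA resolution_dd0 // mul0mx.
have [|g2 g2P] := resolution_lift (A := dif G d.+1 *m g') resF.
  by rewrite -mulmxA -gg' mulmxA resolution_dd0 // mul0mx.
have [|h' h'P] :=
    resolution_lift (A := 1%:M - f' *m g' - dif F d *m h) resF.
  move: hP; rewrite !mulmxBr mulmx1 !mulmxBl mul1mx !mulmxA ff'.
  by rewrite -[_ *m g]mulmxA gg' !mulmxA.
by exists f2, g2, h'.
Qed.

(** The identity of R/I is lifted in both directions, degree by degree. Only two consecutive degrees
    are carried along, which is all that [comparison_step] consumes. *)
Lemma resolution_comparison (F G : free_complex R) (d : nat) :
  is_free_resolution I F -> is_free_resolution I G ->
  exists f f' g g' (h : 'M_(rk F d, rk F d.+1)),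
    [/\ dif F d *m f = f' *m dif G d, dif G d *m g = g' *m dif F d
      & dif F d *m (1%:M - f *m g - h *m dif F d) = 0].
Proof.
move=> resF resG; have I0 := resolution_ideal0 resF.
elim: d => [|d [f [f' [g [g' [h [ff' gg' hP]]]]]]].
  have [eF [surF exF _]] := resF; have [eG [surG exG _]] := resG.
  have [f fP] := augmentation_lift eF I0 surG.
  have [g gP] := augmentation_lift eG I0 surF.
  have [f' ff'] := resolution_chain_map0 exF exG fP.
  have [g' gg'] := resolution_chain_map0 exG exF gP.
  have [h hP] : exists h, 1%:M - f *m g = h *m dif F 0.
    apply: row_lift => v; apply/exF.
    (* The two congruences chain: [v] and [v *m f *m g] have the same augmentation modulo [I], so
       they differ by a boundary. *)
    have := ideal_opp (ideal_add (gP (v *m f)) (fP v)).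
    by rewrite mulmxBr mulmx1 mulmxBl addrA subrK opprB !mulmxA !mxE.
  by exists f, f', g, g', h; rewrite hP subrr mulmx0.
have [f2 [g2 [h' [f2P g2P h'P]]]] := comparison_step resF resG ff' gg' hP.
exists f', f2, g', g2, h'; split=> //.
by rewrite -h'P opprB addrC subrK mulmxA resolution_dd0 // mul0mx.
Qed.

End Comparison.

(** * Independence of Betti numbers from the resolution *)

Section BettiInvariance.

Local Open Scope ring_scope.

(* The homotopy makes f injective on homology. *)
Lemma homology_rank_le (K : fieldType) (a b c a' b' c' : nat)
    (dF : 'M[K]_(b, a)) (dF' : 'M[K]_(c, b))
    (dG : 'M[K]_(b', a')) (dG' : 'M[K]_(c', b'))
    (f0 : 'M_(a, a')) (f : 'M_(b, b')) (g : 'M_(b', b)) (g' : 'M_(c', c))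
    (h : 'M_(a, b)) (h' : 'M_(b, c)) :
  dG' *m dG = 0 -> dF *m f0 = f *m dG -> dG' *m g = g' *m dF' ->
  1%:M - f *m g - dF *m h = h' *m dF' ->
  (\rank (kermx dF) - \rank dF' <= \rank (kermx dG) - \rank dG')%N.
Proof.
move=> dG0 ff gg hh; pose C := cokermx dG'.
have sZf : (kermx dF *m f <= kermx dG)%MS.
  by apply/sub_kermxP; rewrite -mulmxA -ff mulmxA mulmx_ker mul0mx.
have sker : (kermx dF :&: kermx (f *m C) <= dF')%MS.
  apply/row_subP => i; set z := row i _.
  have /andP[/sub_kermxP zF /sub_kermxP]:
      (z <= kermx dF)%MS && (z <= kermx (f *m C))%MS.
    by rewrite -sub_capmx row_sub.
  rewrite mulmxA => /eqP; rewrite -submxE => /submxP[u zf].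
  have: z *m (1%:M - f *m g - dF *m h) = z *m (h' *m dF') by rewrite hh.
  rewrite !mulmxBr mulmx1 !mulmxA zF mul0mx subr0 zf -[u *m _ *m g]mulmxA gg.
  move/eqP; rewrite subr_eq => /eqP ->.
  by rewrite mulmxA addmx_sub // submxMl.
have sG : (dG' <= kermx dG :&: kermx C)%MS.
  by rewrite sub_capmx; apply/andP; split; apply/sub_kermxP; rewrite ?mulmx_coker.
have rF := mxrank_mul_ker (kermx dF) (f *m C).
have rG := mxrank_mul_ker (kermx dG) C.
have := mxrankS sker; have := mxrankS sG.
have := mxrankS (submxMr C sZf); rewrite -mulmxA; lia.
Qed.

Variables (K : fieldType) (k : nat) (I : {mpoly K[k]} -> Prop).
Hypothesis ideal_add : forall a b, I a -> I b -> I (a + b).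
Hypothesis ideal_mul : forall c a, I a -> I (c * a).

(** Evaluation at the origin is a ring morphism, so chain maps and homotopy survive modulo the
    variables. *)
Lemma dim_homology_at0_le (F G : free_complex {mpoly K[k]}) (d : nat) :
  is_free_resolution I F -> is_free_resolution I G ->
  (dim_homology_at0 F d.+1 <= dim_homology_at0 G d.+1)%N.
Proof.
move=> resF resG.
have [f [f' [g [g' [h [ff' gg' hP]]]]]] :=
  resolution_comparison ideal_add ideal_mul d resF resG.
have [f2 [g2 [h' [_ g2P h'P]]]] := comparison_step resF resG ff' gg' hP.
pose ev := @meval _ K (fun _ : 'I_k => 0).
apply: (@homology_rank_le _ _ _ _ _ _ _ _ _ _ _ (map_mx ev f) (map_mx ev f')
          (map_mx ev g') (map_mx ev g2) (map_mx ev h) (map_mx ev h')).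
- by rewrite -map_mxM (resolution_dd0 _ resG) map_mx0.
- by rewrite -!map_mxM ff'.
- by rewrite -!map_mxM g2P.
- by rewrite -!map_mxM -h'P !map_mxB !map_mxM map_mx1.
Qed.

(** [F] shows that [epsilon] has something to choose; the chosen value comes from some resolution
    [G], and the inequality in both directions identifies it. *)
Lemma betti_resolution (F : free_complex {mpoly K[k]}) (d : nat) :
  is_free_resolution I F -> betti I d.+1 = dim_homology_at0 F d.+1.
Proof.
move=> resF; rewrite /betti.
have [|G resG <-] := epsilon_spec (inhabits 0%N) (fun b : nat =>
    exists2 F, is_free_resolution I F & dim_homology_at0 F d.+1 = b).
  by exists (dim_homology_at0 F d.+1), F.
by apply/eqP; rewrite eqn_leq !dim_homology_at0_le.
Qed.

End BettiInvariance.

(** * The Koszul complex of commuting matrices and its contraction *)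

Section KoszulComplex.

Local Open Scope ring_scope.

Variables (R : comNzRingType) (N p : nat) (Y : 'I_N -> 'M[R]_p).

Definition koszul_cell (d : nat) : pred ({set 'I_N} * 'I_p) :=
  [pred x : {set 'I_N} * 'I_p | #|x.1| == d].

Definition koszul_sign (i : 'I_N) (S : {set 'I_N}) : nat :=
  #|[set j in S | (j < i)%N]|.

(** At most one [i] contributes, the one removed from [x.1] to get [y.1]; the sum avoids choosing
    it. *)
Definition koszul_coef (x y : {set 'I_N} * 'I_p) : R :=
  \sum_(i | (i \notin y.1) && (x.1 == i |: y.1))
     (-1) ^+ koszul_sign i y.1 * Y i x.2 y.2.

Definition koszul : free_complex R :=
  @FreeComplex R (fun d => #|koszul_cell d|)
    (fun d => \matrix_(r, c) koszul_coef (enum_val r) (enum_val c)).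

Lemma rk_koszul d : rk koszul d = ('C(N, d) * p)%N.
Proof.
rewrite /= -[in RHS](card_ord N) -card_draws -[X in (_ * X)%N]card_ord -cardsT.
by rewrite -cardsX; apply: eq_card => -[S j]; rewrite in_setX !inE andbT.
Qed.

(* The coefficient of a chain at the basis vector e_S is z S, in R^p. *)
Definition koszul_d (z : {set 'I_N} -> 'rV[R]_p) (S : {set 'I_N}) : 'rV[R]_p :=
  \sum_(i | i \notin S) (-1) ^+ koszul_sign i S *: (z (i |: S) *m Y i).

(** Functions on all subsets free the computations from degrees and enumerations; packing keeps the
    sets of size [d], unpacking extends by zero. *)
Definition koszul_pack d (z : {set 'I_N} -> 'rV[R]_p) : 'rV[R]_(rk koszul d) :=
  \row_c z (enum_val c).1 0 (enum_val c).2.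

Definition koszul_unpack d (v : 'rV[R]_(rk koszul d)) (S : {set 'I_N}) :
    'rV[R]_p :=
  \row_j \sum_c v 0 c *+ (enum_val c == (S, j)).

Lemma koszul_unpackK d : cancel (@koszul_unpack d) (koszul_pack d).
Proof.
move=> v; apply/rowP => c; rewrite !mxE (bigD1 c) //= -surjective_pairing eqxx.
rewrite big1 ?addr0 // => c' c'c.
by rewrite (inj_eq enum_val_inj) (negPf c'c).
Qed.

Lemma koszul_unpack_support d v (S : {set 'I_N}) : #|S| != d -> @koszul_unpack d v S = 0.
Proof.
move=> Sd; apply/rowP => j; rewrite !mxE big1 // => c _.
case: eqP => // cS; have := enum_valP c.
by rewrite cS unfold_in /= (negPf Sd).
Qed.

Lemma koszul_pack_inj d z z' (S : {set 'I_N}) :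
  koszul_pack d z = koszul_pack d z' -> #|S| = d -> z S = z' S.
Proof.
move=> /rowP zz' Sd; apply/rowP => j.
have Sj : (S, j) \in koszul_cell d by rewrite unfold_in /= Sd.
by have := zz' (enum_rank_in Sj (S, j)); rewrite !mxE enum_rankK_in.
Qed.

Lemma eq_koszul_pack d z z' :
  (forall S : {set 'I_N}, #|S| = d -> z S = z' S) -> koszul_pack d z = koszul_pack d z'.
Proof.
move=> zz'; apply/rowP => c; rewrite !mxE zz' //.
by have := enum_valP c; rewrite unfold_in => /eqP.
Qed.

Lemma koszul_packM d z :
  koszul_pack d.+1 z *m dif koszul d = koszul_pack d (koszul_d z).
Proof.
apply/rowP => c; rewrite !mxE.
set y := enum_val c; have /eqP yd : #|y.1| == d := enum_valP c.
under eq_bigr do rewrite !mxE.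
rewrite -(big_enum_val (A := koszul_cell d.+1)
           (fun x => z x.1 0 x.2 * koszul_coef x y)).
rewrite summxE; under [RHS]eq_bigr do rewrite 2!mxE big_distrr /=.
under eq_bigr do rewrite big_distrr /= big_mkcondr /=.
rewrite exchange_big /=; apply: eq_bigr => i iy.
rewrite -big_mkcondr /=.
rewrite (reindex_onto (fun j : 'I_p => (i |: y.1, j)) snd) /=; last first.
  by move=> [S j] /= /andP[_ /eqP ->].
apply: eq_big => [j|j _]; last by rewrite mulrCA.
by rewrite unfold_in /= cardsU1 iy yd !eqxx.
Qed.

Lemma koszul_signU (i j : 'I_N) (S : {set 'I_N}) : j \notin S ->
  koszul_sign i (j |: S) = ((j < i) + koszul_sign i S)%N.
Proof.
move=> jS; rewrite /koszul_sign; have [ji|ij] := ltnP j i; last first.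
  rewrite add0n; congr #|pred_of_set _|; apply/setP => l; rewrite !inE.
  by case: (l =P j) => [->|]; rewrite //= ltnNge ij andbF.
have -> : true = (j \notin [set l in S | (l < i)%N]) by rewrite inE (negPf jS).
rewrite -cardsU1; congr #|pred_of_set _|; apply/setP => l; rewrite !inE.
by case: (l =P j) => [->|].
Qed.

Lemma koszul_sign_swap (i j : 'I_N) (S : {set 'I_N}) :
  i != j -> i \notin S -> j \notin S ->
  (-1) ^+ (koszul_sign i (j |: S) + koszul_sign j (i |: S))
  = - (-1) ^+ (koszul_sign i S + koszul_sign j S) :> R.
Proof.
move=> ij iS jS; rewrite !koszul_signU //.
rewrite -[in RHS]mulN1r -exprS -[LHS]signr_odd -[RHS]signr_odd; congr (_ ^+ _).
by move: ij; rewrite -val_eqE neq_ltn /= !oddD => /orP[lt|lt];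
   rewrite lt ltnNge ltnW //= ?addbT ?addTb; do 2!case: odd.
Qed.

Hypothesis Y_comm : forall i j, Y i *m Y j = Y j *m Y i.

(** The matrices commute and the signs are opposite, so the terms of (i, j) and (j, i) cancel. *)
Lemma koszul_dd0 z S : koszul_d (koszul_d z) S = 0.
Proof.
rewrite /koszul_d.
pose F i j := (-1) ^+ (koszul_sign i S + koszul_sign j (i |: S))
    *: (z (i |: (j |: S)) *m (Y i *m Y j)) : 'rV_p.
have FE i : i \notin S -> (-1) ^+ koszul_sign i S *:
   ((\sum_(j | j \notin i |: S) (-1) ^+ koszul_sign j (i |: S) *:
       (z (j |: (i |: S)) *m Y j)) *m Y i)
   = \sum_(j | (j \notin S) && (j != i)) F i j.
  move=> iS; rewrite mulmx_suml scaler_sumr; apply: eq_big => [j|j _].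
    by rewrite !inE negb_or andbC.
  by rewrite -scalemxAl scalerA -exprD /F -mulmxA Y_comm setUCA.
rewrite (eq_bigr _ FE).
have split1 : \sum_(i | i \notin S) \sum_(j | (j \notin S) && (j != i)) F i j
   = \sum_(i | i \notin S) \sum_(j | (j \notin S) && (i < j)%N) (F i j + F j i).
  under [RHS]eq_bigr do rewrite big_split.
  rewrite big_split /= [X in _ = _ + X]
     (exchange_big_dep (fun i => i \notin S)) /=; last by move=> ? ? ? /andP[].
  rewrite -big_split; apply: eq_bigr => i iS.
  rewrite (bigID (fun j : 'I_N => (i < j)%N)) /=; congr (_ + _).
    apply: eq_bigl => j; rewrite -andbA; congr (_ && _).
    by case: (ltnP i j) => ij; rewrite ?andbF // andbT -val_eqE gtn_eqF.
  by apply: eq_bigl => j; rewrite iS -andbA -leqNgt -val_eqE -ltn_neqAle andbC.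
rewrite split1 big1 // => i iS; rewrite big1 // => j /andP[jS ij].
have neq_ij : i != j by rewrite -val_eqE ltn_eqF.
rewrite /F Y_comm setUCA -scalerDl.
suff -> : (-1) ^+ (koszul_sign j S + koszul_sign i (j |: S))
   = - (-1) ^+ (koszul_sign i S + koszul_sign j (i |: S)) :> R.
  by rewrite subrr scale0r.
rewrite [in LHS]koszul_signU // [in RHS]koszul_signU //.
rewrite -[in RHS]mulN1r -exprS -[LHS]signr_odd -[RHS]signr_odd; congr (_ ^+ _).
by rewrite !oddS !oddD ij ltnNge ltnW //=; do 2!case: odd.
Qed.

Lemma koszul_dif_dif d (v : 'rV_(rk koszul d.+2)) :
  v *m dif koszul d.+1 *m dif koszul d = 0.
Proof.
rewrite -[v]koszul_unpackK !koszul_packM.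
by apply/rowP => c; rewrite !mxE koszul_dd0 mxE.
Qed.

(** A left inverse of [Y k] compatible with the other operators. It is asked for on the values of
    [z] because synthetic division is cut off at a bound for their degrees. *)
Hypothesis Y_retract : forall (k : 'I_N) (z : {set 'I_N} -> 'rV[R]_p),
  exists h : {additive 'rV[R]_p -> 'rV[R]_p},
    (forall i u, i != k -> h (u *m Y i) = h u *m Y i)
    /\ (forall S, h (z S *m Y k) = z S).

(** [h] contracts the complex in direction [k]. The second claim preserves vanishing obtained for
    other indices, so that the indices can be treated one after another. *)
Lemma koszul_kill (k : 'I_N) z : (forall S, koszul_d z S = 0) ->
  exists w, (forall S : {set 'I_N}, k \in S -> z S = koszul_d w S) /\
    (forall j, j != k -> (forall S : {set 'I_N}, j \in S -> z S = 0) ->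
        (forall S : {set 'I_N}, j \in S -> koszul_d w S = 0)).
Proof.
move=> dz; have [h [hY hK]] := Y_retract k z.
pose w (S : {set 'I_N}) := if k \in S
  then (-1) ^+ koszul_sign k (S :\ k) *: h (z (S :\ k)) else 0 : 'rV_p.
exists w; split=> [S kS|j jk zj S jS]; last first.
  rewrite /koszul_d big1 // => i _; rewrite /w; case: ifP => _.
    by rewrite zj ?raddf0 ?scaler0 ?mul0mx ?scaler0 // !inE jk jS orbT.
  by rewrite mul0mx scaler0.
pose T := S :\ k; have kT : k \notin T by rewrite !inE eqxx.
have ST : S = k |: T by rewrite setD1K.
(* Applying [h] to the cycle condition at [T] isolates the term of [k], which is [z S] up to
   sign. *)
have := congr1 h (dz T); rewrite raddf0 /koszul_d raddf_sum /= (bigD1 k) //=.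
rewrite raddfZsign -ST hK => /eqP; rewrite addr_eq0 => /eqP zS.
rewrite -[LHS](signrZK (koszul_sign k T)) zS scalerN scaler_sumr -sumrN.
apply: eq_big => [i|i /andP[iT ik]]; first by rewrite ST !inE negb_or andbC.
have iS : (i |: S) :\ k = i |: T.
  apply/setP => l; rewrite !inE; case: (l =P k) => // -> /=.
  by rewrite eq_sym (negPf ik).
rewrite /w !inE kS orbT iS (raddfZsign h) hY // -scalemxAl !scalerA -!exprD -scaleNr.
congr (_ *: _); rewrite ST koszul_sign_swap // addnC //.
Qed.

(** By induction on [n], subtracting a boundary makes the cycle vanish on all sets that meet the
    first [n] indices; for [n = N] these are all nonempty sets. *)
Lemma koszul_exact z : (forall S, koszul_d z S = 0) ->
  exists w, forall S, S != set0 -> z S = koszul_d w S.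
Proof.
move=> dz.
suff /(_ N)[w wP] : forall n, exists w, forall k : 'I_N, (k < n)%N ->
    forall S : {set 'I_N}, k \in S -> z S = koszul_d w S.
  by exists w => S /set0Pn[k kS]; apply: wP kS.
elim=> [|n [w wP]]; first by exists (fun=> 0) => k; rewrite ltn0.
case: (ltnP n N) => [ltnN|leNn]; last first.
  by exists w => k _; apply: wP; apply: leq_trans leNn.
pose z' S := z S - koszul_d w S.
have koszul_dD u u' S : koszul_d (fun S => u S + u' S) S
    = koszul_d u S + koszul_d u' S.
  by rewrite -big_split; apply: eq_bigr => i _; rewrite mulmxDl scalerDr.
have dz' S : koszul_d z' S = 0.
  suff : koszul_d (fun S => z' S + koszul_d w S) S = 0.
    by rewrite koszul_dD koszul_dd0 addr0.
  rewrite -[RHS](dz S); apply: eq_bigr => i _.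
  by rewrite subrK.
have [w' [w'k w'j]] := koszul_kill (Ordinal ltnN) dz'.
exists (fun S => w S + w' S) => k; rewrite ltnS => lekn S kS.
rewrite koszul_dD; case: (k =P Ordinal ltnN) => [eqk|/eqP neqk].
  by rewrite -w'k -?eqk // addrC subrK.
have ltkn : (k < n)%N by rewrite ltn_neqAle lekn andbT.
have z'k (S' : {set 'I_N}) : k \in S' -> z' S' = 0 by move=> kS'; rewrite /z' -(wP k) ?subrr.
by rewrite (w'j k) // addr0; apply: wP kS.
Qed.

Lemma koszul_resolves d (v : 'rV_(rk koszul d.+1)) :
  v *m dif koszul d = 0 <-> exists w, v = w *m dif koszul d.+1.
Proof.
split=> [v0|[w ->]]; last exact: koszul_dif_dif.
have [|w wP] := @koszul_exact (koszul_unpack v).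
  move=> S; have [Sd|Sd] := eqVneq #|S| d.
    apply: (koszul_pack_inj (z' := fun=> 0)) Sd.
    by rewrite -koszul_packM koszul_unpackK v0; apply/rowP => c; rewrite !mxE.
  rewrite /koszul_d big1 // => i iS.
  by rewrite koszul_unpack_support ?mul0mx ?scaler0 // cardsU1 iS eqSS.
exists (koszul_pack d.+2 w); rewrite koszul_packM -[LHS]koszul_unpackK.
by apply: eq_koszul_pack => S Sd; rewrite wP // -card_gt0 Sd.
Qed.

Lemma koszul_image0 (v : 'rV_(rk koszul 0)) :
  (exists w, v = w *m dif koszul 0) <->
  exists u : 'I_N -> 'rV_p, koszul_unpack v set0 = \sum_i u i *m Y i.
Proof.
have d0 z : koszul_d z set0 = \sum_i z [set i] *m Y i.
  rewrite /koszul_d; apply: eq_big => [i|i _]; first by rewrite inE.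
  rewrite /koszul_sign (_ : [set j in _ | _] = set0) ?cards0 ?scale1r ?setU0 //.
  by apply/setP => j; rewrite !inE.
split=> [[w vw]|[u vu]].
  exists (fun i => koszul_unpack w [set i]); rewrite -d0.
  apply: (koszul_pack_inj (d := 0)); last exact: cards0.
  by rewrite -koszul_packM !koszul_unpackK.
pose z S := \sum_(i | S == [set i]) u i.
exists (koszul_pack 1 z); rewrite koszul_packM -[LHS]koszul_unpackK.
apply: eq_koszul_pack => S /eqP; rewrite cards_eq0 => /eqP ->.
rewrite d0 vu; apply: eq_bigr => i _; rewrite /z (big_pred1 i) // => j.
by rewrite eq_sym; apply/eqP/eqP => [/set1_inj|->].
Qed.

End KoszulComplex.

(** * Rank of a sparse matrix from its pivots *)

Section PivotRank.

Local Open Scope ring_scope.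

(** The rows [f t] span the row space, and their submatrix on the columns [g t] is diagonal with
    nonzero entries, so they form a basis. *)
Lemma rank_pivots (K : fieldType) (A B U : finType) (P : pred A) (Q : pred B)
    (T : pred U) (E : A -> B -> K) (f : U -> A) (g : U -> B) :
  (forall t, t \in T -> f t \in P) -> (forall t, t \in T -> g t \in Q) ->
  (forall t t', t \in T -> t' \in T -> (E (f t) (g t') != 0) = (t == t')) ->
  (forall x, x \in P -> (forall y, E x y = 0)
     \/ exists2 t, t \in T & exists a, forall y, E x y = a * E (f t) y) ->
  \rank (\matrix_(r < #|P|, c < #|Q|) E (enum_val r) (enum_val c)) = #|T|.
Proof.
move=> fP gQ Efg spanE; set M := matrix_of_fun _ _.
pose D := \matrix_(t < #|T|, c < #|Q|) E (f (enum_val t)) (enum_val c).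
have MD : (M :=: D)%MS.
  apply/eqmxP/andP; split; apply/row_subP => i.
    have [E0|[t tT [a Ea]]] := spanE _ (enum_valP i).
      by rewrite (_ : row i M = 0) ?sub0mx //; apply/rowP => c; rewrite !mxE.
    rewrite (_ : row i M = a *: row (enum_rank_in tT t) D).
      by rewrite scalemx_sub // row_sub.
    by apply/rowP => c; rewrite !mxE Ea enum_rankK_in.
  have fiP := fP _ (enum_valP i).
  rewrite (_ : row i D = row (enum_rank_in fiP (f (enum_val i))) M) ?row_sub //.
  by apply/rowP => c; rewrite !mxE enum_rankK_in.
rewrite MD; apply/eqP; rewrite -/(row_free D) -kermx_eq0; apply/eqP.
apply/row_matrixP => i; rewrite row0; set v := row i _.
have /rowP vD : v *m D = 0 by apply/sub_kermxP; rewrite row_sub.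
apply/rowP => t; rewrite [RHS]mxE; move: v vD => v vD.
have gtQ := gQ _ (enum_valP t).
have := vD (enum_rank_in gtQ (g (enum_val t))); rewrite !mxE.
rewrite (bigD1 t) //= big1 => [|t' t't].
  rewrite addr0 [D _ _]mxE enum_rankK_in // => /eqP; rewrite mulf_eq0.
  by have := Efg _ _ (enum_valP t) (enum_valP t); rewrite eqxx => /negPf ->;
     rewrite orbF => /eqP.
rewrite [D _ _]mxE enum_rankK_in //.
have := Efg _ _ (enum_valP t') (enum_valP t).
by rewrite (inj_eq enum_val_inj) (negPf t't) => /negbFE/eqP ->; rewrite mulr0.
Qed.

End PivotRank.

(** * Koszul ranks over a graded algebra with Hilbert function (1, N, 1) *)

Section KoszulRank.

Local Open Scope ring_scope.

(* Y i is multiplication by the i-th variable, up to the factor c, on the graded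
   algebra with basis o in degree 0, eps i in degree 1, w in degree 2, where
   x_i x_i' = w if pr i i' and x_i x_i' = 0 otherwise. *)
Variables (K : fieldType) (N p : nat) (Y : 'I_N -> 'M[K]_p) (c : K).
Variables (o w : 'I_p) (eps : 'I_N -> 'I_p) (pr : rel 'I_N) (i0 : 'I_N).
Hypothesis c_neq0 : c != 0.
Hypothesis basisP : forall j, [\/ j = o, j = w | exists i, j = eps i].
Hypothesis eps_inj : injective eps.
Hypothesis eps_w : forall i, eps i != w.
Hypothesis pr_inj : forall i j l, pr i l -> pr j l -> i = j.
Hypothesis Y_o : forall i j, Y i o j = c *+ (j == eps i).
Hypothesis Y_eps : forall i i' j, Y i (eps i') j = c *+ ((j == w) && pr i i').
Hypothesis Y_w : forall i j, Y i w j = 0.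

(** The set R covered by the matching. *)
Definition paired : {set 'I_N} := [set i | [exists i', pr i i']].

Lemma koszul_coef_eps i i' (S : {set 'I_N}) y : pr i i' -> i \notin S ->
  koszul_coef Y (i |: S, eps i') y
  = ((-1) ^+ koszul_sign i S * c) *+ (y == (S, w)).
Proof.
case: y => S' k pri iS; rewrite /koszul_coef /= big_mkcond (bigD1 i) //=.
rewrite big1 ?addr0 => [|j ji]; last first.
  case: ifP => // _; rewrite Y_eps [pr j i'](_ : _ = false) ?andbF ?mulr0 //.
  by apply: contraNF ji => /pr_inj/(_ pri) ->.
rewrite Y_eps pri andbT xpair_eqE.
case: (S' =P S) => [->|SS'] /=; first by rewrite iS eqxx /= -mulrnAr.
case: ifP => // /andP[iS' /eqP eqS]; case: SS'.
by rewrite -(setU1K iS') -eqS setU1K.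
Qed.

Lemma koszul_coef_eps0 i' (S : {set 'I_N}) y :
  (forall i, pr i i' -> i \notin S) -> koszul_coef Y (S, eps i') y = 0.
Proof.
move=> prS; rewrite /koszul_coef big1 // => i /andP[_ /eqP /= SE].
rewrite Y_eps; case: (boolP (pr i i')) => [/prS|]; last by rewrite andbF mulr0.
by rewrite SE setU11.
Qed.

Lemma koszul_coef_o (S' S : {set 'I_N}) i : koszul_coef Y (S', o) (S, eps i)
  = if (i \notin S) && (S' == i |: S) then (-1) ^+ koszul_sign i S * c else 0.
Proof.
rewrite /koszul_coef /= big_mkcond (bigD1 i) //= big1 ?addr0 => [|j ji].
  by rewrite Y_o eqxx.
by rewrite Y_o (inj_eq eps_inj) [i == j]eq_sym (negPf ji) mulr0 if_same.
Qed.

Lemma koszul_coef_ow S' S : koszul_coef Y (S', o) (S, w) = 0.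
Proof.
rewrite /koszul_coef big1 // => i _.
by rewrite Y_o eq_sym (negPf (eps_w i)) mulr0.
Qed.

Lemma koszul_coef_w S' y : koszul_coef Y (S', w) y = 0.
Proof. by rewrite /koszul_coef big1 // => i _; rewrite Y_w mulr0. Qed.

Lemma signc_neq0 n : (-1) ^+ n * c != 0.
Proof. by rewrite mulf_neq0 // signr_eq0. Qed.

(** [inl A] stands for the row [(A, o)]; [inr A] for the column [(A, w)], which is hit exactly when
    a paired index lies outside [A]. *)
Definition pivots d : pred ({set 'I_N} + {set 'I_N}) := fun t =>
  match t with
  | inl A => #|A| == d.+1
  | inr A => (#|A| == d) && ~~ (paired \subset A)
  end.

(** Rows over [w] vanish, rows over some [eps i'] have at most one nonzero entry, in a column over
    [w], and rows over [o] only meet columns over the [eps i]. The two kinds of pivots thus do not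
    interfere. *)
Lemma rank_koszul d : \rank (dif (koszul Y) d) = #|pivots d|.
Proof.
have /fin_all_exists[l lP] (S : {set 'I_N}) : exists i, S != set0 -> i \in S.
  have [->|/set0Pn[i iS]] := eqVneq S set0; last by exists i.
  by exists i0.
have /fin_all_exists[r rP] (S : {set 'I_N}) : exists q : 'I_N * 'I_N,
    ~~ (paired \subset S) -> (q.1 \notin S) && pr q.1 q.2.
  have [sS|/subsetPn[i]] := boolP (paired \subset S); first by exists (i0, i0).
  by rewrite inE => /existsP[i' pri] iS; exists (i, i'); rewrite iS.
(* The row [(A, o)] is paired with the column that removes any element [l A]; the column [(A, w)]
   with the row of any matched pair [r A] whose first member is outside [A]. *)
pose f t := match t with
  | inl A => (A, o) | inr A => ((r A).1 |: A, eps (r A).2) end.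
pose g t := match t with
  | inl A => (A :\ l A, eps (l A)) | inr A => (A, w) end.
have lT (S : {set 'I_N}) : #|S| == d.+1 -> l S \in S.
  by move=> /eqP Sd; apply: lP; rewrite -card_gt0 Sd.
apply: (rank_pivots (T := pivots d) (f := f) (g := g)).
- case=> S; rewrite !unfold_in //= => /andP[Sd /rP/andP[rS _]].
  by rewrite cardsU1 rS (eqP Sd).
- case=> S; rewrite !unfold_in /=; last by case/andP.
  move=> Sd; by have := cardsD1 (l S) S; rewrite lT // (eqP Sd) add1n => -[<-].
- case=> S [] S'; rewrite !unfold_in /=.
  + move=> Sd S'd; rewrite koszul_coef_o setD1K ?lT // !inE eqxx /=.
    rewrite -[RHS]/(S == S').
    by case: (S == S'); rewrite ?signc_neq0 ?eqxx.
  + by move=> _ _; rewrite koszul_coef_ow eqxx.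
  + move=> /andP[_ /rP/andP[rS prr]] _; rewrite koszul_coef_eps //.
    by rewrite xpair_eqE (negPf (eps_w _)) andbF eqxx.
  + move=> /andP[_ /rP/andP[rS prr]] _; rewrite koszul_coef_eps //.
    rewrite xpair_eqE eqxx andbT [S' == S]eq_sym.
    rewrite -[RHS]/(S == S').
    by case: (S == S'); rewrite ?signc_neq0 ?eqxx.
case=> S j; rewrite unfold_in /= => Sd; have [->|->|[i' ->]] := basisP j.
- by right; exists (inl S) => //; exists 1 => y; rewrite mul1r.
- by left=> y; rewrite koszul_coef_w.
have [/existsP[i /andP[pri iS]]|no_i] := boolP [exists i, pr i i' && (i \in S)].
  right; exists (inr (S :\ i)).
    rewrite unfold_in /=; have := cardsD1 i S; rewrite iS (eqP Sd) add1n => -[<-].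
    rewrite eqxx; apply/subsetPn; exists i; rewrite !inE ?eqxx //.
    by apply/existsP; exists i'.
  set S' := S :\ i; have iS' : i \notin S' by rewrite !inE eqxx.
  have SE : S = i |: S' by rewrite setD1K.
  have /rP/andP[rS prr] : ~~ (paired \subset S').
    apply/subsetPn; exists i => //; rewrite inE; apply/existsP; by exists i'.
  exists ((-1) ^+ koszul_sign i S' * c / ((-1) ^+ koszul_sign (r S').1 S' * c)) => y.
  rewrite SE /f !koszul_coef_eps //; case: (y == _); last by rewrite mulr0.
  by rewrite !mulr1n divfK // signc_neq0.
left=> y; apply: koszul_coef_eps0 => i pri; apply: contra no_i => iS.
by apply/existsP; exists i; rewrite pri.
Qed.

(** Sets of size [d] containing [paired] correspond, by removing it, to subsets of its complement.
    Without the guard, truncated subtraction would yield ['C(_, 0) = 1] for smaller [d]. *)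
Lemma card_pivots d :
  (#|pivots d| + (if #|paired| <= d then 'C(N - #|paired|, d - #|paired|) else 0)
   = 'C(N, d.+1) + 'C(N, d))%N.
Proof.
have -> : #|pivots d| = (#|[set S : {set 'I_N} | #|S| == d.+1]|
    + #|[set S : {set 'I_N} | #|S| == d] :\: [set S : {set 'I_N} | paired \subset S]|)%N.
  have := big_sumType addn (pivots d) (fun=> 1%N).
  rewrite !sum1_card => ->; congr (_ + _)%N; apply: eq_card => S.
    by rewrite !inE.
  by rewrite !inE andbC.
have -> : (if #|paired| <= d then 'C(N - #|paired|, d - #|paired|) else 0)%N =
   #|[set S : {set 'I_N} | #|S| == d] :&: [set S : {set 'I_N} | paired \subset S]|.
  have [le_d|lt_d] := leqP #|paired| d; last first.
    apply/esym/eqP; rewrite cards_eq0; apply/eqP/setP => S; rewrite !inE.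
    apply/negbTE/negP => /andP[/eqP Sd /subset_leq_card].
    by rewrite Sd leqNgt lt_d.
  have -> : (N - #|paired|)%N = #|~: paired|.
    by rewrite [RHS]cardsCs setCK card_ord.
  rewrite -cards_draws.
  rewrite -(card_in_imset (f := fun S : {set 'I_N} => S :|: paired)).
    congr #|pred_of_set _|; apply/setP => S; rewrite !inE.
    apply/imsetP/andP => [[S']|[/eqP Sd sS]].
      rewrite inE => /andP[sS' /eqP S'd] ->; rewrite subsetUr cardsU S'd.
      move: sS'; rewrite subsets_disjoint setCK -setI_eq0 => /eqP ->.
      by rewrite cards0 subn0 subnK.
    exists (S :\: paired); last first.
      apply/setP => i; rewrite in_setU in_setD.
      by case: (boolP (i \in paired)) => [/(subsetP sS) ->|_]; rewrite /= ?orbT ?orbF.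
    by rewrite inE cardsD (setIidPr sS) Sd eqxx andbT setDE subsetIr.
  move=> S S'; rewrite !inE => /andP[sS _] /andP[sS' _] eqS.
  have dis (X : {set 'I_N}) : X \subset ~: paired -> (X :|: paired) :\: paired = X.
    move=> sX; apply/setP => i; rewrite in_setD in_setU.
    case: (boolP (i \in X)) => [/(subsetP sX)|_]; first by rewrite in_setC => ->.
    by case: (i \in paired).
  by rewrite -(dis _ sS) eqS dis.
by rewrite !card_draws !card_ord -addnA [(#|_ :\: _| + _)%N]addnC cardsID card_draws card_ord.
Qed.

End KoszulRank.

(** * Division of polynomials by a variable *)

Section DropVariable.

Local Open Scope ring_scope.

Variables (K : fieldType) (k : nat).
Local Notation Q := {mpoly K[k]}.

(* Deletes the monomials free of 'X_j and divides the others by 'X_j. *)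
Definition mdrop (j : 'I_k) (p : Q) : Q :=
  \sum_(u : 'X_{1..k < msize p}) p@_(u + U_(j)) *: 'X_[u].

Lemma mcoeff_mdrop j p u : (mdrop j p)@_u = p@_(u + U_(j)).
Proof.
have [lt_u|le_u] := ltnP (mdeg u) (msize p).
  exact: (mcoeff_mpoly (fun u => p@_(u + U_(j)))).
rewrite [RHS]memN_msupp_eq0; last first.
  by apply: msize_mdeg_ge; rewrite mdegD (leq_trans le_u) ?leq_addr.
rewrite raddf_sum big1 //= => v _; rewrite mcoeffZ mcoeffX.
case: eqP => [vu|_]; last by rewrite mulr0.
by have := bmdeg v; rewrite vu ltnNge le_u.
Qed.

Lemma mdrop_is_additive j : additive (mdrop j).
Proof. by move=> p q; apply/mpolyP => u; rewrite !(mcoeff_mdrop, mcoeffB). Qed.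

HB.instance Definition _ j :=
  GRing.isAdditive.Build Q Q (mdrop j) (mdrop_is_additive j).

Lemma mcoeffMXU0 i (p : Q) (u : 'X_{1..k}) : u i = 0%N -> (p * 'X_i)@_u = 0.
Proof.
move=> ui; apply: memN_msupp_eq0; rewrite (perm_mem (msuppMX _ _)).
by apply/mapP => -[v _ uE]; move: ui; rewrite uE mnmDE mnm1E eqxx.
Qed.

Lemma mdropXK j p : mdrop j (p * 'X_j) = p.
Proof. by apply/mpolyP => u; rewrite mcoeff_mdrop addmC mcoeffMX. Qed.

Lemma mdropMX i j p : i != j -> mdrop j (p * 'X_i) = mdrop j p * 'X_i.
Proof.
move=> ij; apply/mpolyP => u; rewrite mcoeff_mdrop.
have [ui|ui] := posnP (u i).
  by rewrite !mcoeffMXU0 // mnmDE ui mnm1E eq_sym (negPf ij).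
have -> : u = (U_(i) + (u - U_(i)))%MM.
  apply/mnmP => l; rewrite mnmDE mnmBE mnm1E.
  by case: (i =P l) => [<-|]; rewrite ?subnKC // add0n subn0.
by rewrite -addmA !mcoeffMX mcoeff_mdrop.
Qed.

(** The iterate only sees coefficients of [p] at monomials divisible by the [L]-th power of the
    variable, whose degree is too large. *)
Lemma mdrop_nilpotent j p L : (msize p <= L)%N -> iter L (mdrop j) p = 0.
Proof.
move=> le_pL; apply/mpolyP => u; rewrite mcoeff0.
have -> : (iter L (mdrop j) p)@_u = p@_(u + U_(j) *+ L).
  elim: L u {le_pL} => [|L IH] u; first by rewrite mulm0n addm0.
  by rewrite iterS mcoeff_mdrop IH -addmA mulmS.
apply/memN_msupp_eq0/msize_mdeg_ge; rewrite mdegD mdegMn mdeg1 mul1n.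
exact: leq_trans (leq_addl _ _).
Qed.

End DropVariable.

(** * Synthetic division by x - X *)

Section SyntheticDivision.

Local Open Scope ring_scope.

Variables (R : comNzRingType) (p : nat) (s : {additive R -> R}).
Variables (X : 'M[R]_p.+1) (L : nat).
Local Notation linear_at z := (forall y, s (y * z) = s y * z).

(* When s divides by a variable x, this is the quotient of u by x - X. *)
Definition mx_div (u : 'rV[R]_p.+1) : 'rV[R]_p.+1 :=
  \sum_(b < L) map_mx (iter b.+1 s) u *m X ^+ b.

Lemma iter_additiveB n : {morph iter n s : x y / x - y}.
Proof. by elim: n => // n IH x y; rewrite !iterS IH raddfB. Qed.

Lemma mx_div_is_additive : additive mx_div.
Proof.
move=> u v; rewrite /mx_div -sumrB; apply: eq_bigr => b _.
rewrite -mulmxBl; congr (_ *m _); apply/rowP => j.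
by rewrite !mxE iter_additiveB.
Qed.

HB.instance Definition _ :=
  GRing.isAdditive.Build 'rV[R]_p.+1 'rV[R]_p.+1 mx_div mx_div_is_additive.

Lemma map_iter_mulmx n (Z : 'M[R]_p.+1) (u : 'rV_p.+1) :
  (forall i j, linear_at (Z i j)) ->
  map_mx (iter n s) (u *m Z) = map_mx (iter n s) u *m Z.
Proof.
move=> sZ; apply/rowP => j; rewrite !mxE.
have -> : iter n s (\sum_i u 0 i * Z i j) = \sum_i iter n s (u 0 i * Z i j).
  elim: n => // n IH; rewrite iterS IH raddf_sum; apply: eq_bigr => i _.
  by rewrite iterS.
apply: eq_bigr => i _; rewrite mxE; elim: n => // n IH.
by rewrite !iterS IH sZ.
Qed.

Lemma mx_divM (Z : 'M[R]_p.+1) (u : 'rV_p.+1) :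
  (forall i j, linear_at (Z i j)) -> X *m Z = Z *m X ->
  mx_div (u *m Z) = mx_div u *m Z.
Proof.
move=> sZ XZ; rewrite /mx_div mulmx_suml; apply: eq_bigr => b _.
rewrite map_iter_mulmx // -!mulmxA; congr (_ *m _).
exact: (commrX b (esym XZ : GRing.comm Z X)).
Qed.

(** The geometric series for 1/(x - X) telescopes; its last term vanishes because [L] iterations of
    [s] kill [u]. *)
Lemma mx_divK (x : R) (u : 'rV_p.+1) :
  (forall y, s (x * y) = y) -> (forall i j, linear_at (X i j)) ->
  map_mx (iter L s) u = 0 -> mx_div (u *m (x%:M - X)) = u.
Proof.
move=> sx sX uL; pose G b := map_mx (iter b s) u *m X ^+ b.
have -> : mx_div (u *m (x%:M - X)) = - \sum_(0 <= b < L) (G b.+1 - G b).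
  rewrite /mx_div big_mkord -sumrN; apply: eq_bigr => b _.
  rewrite mulmxBr mul_mx_scalar opprB /G exprS -mulmxE mulmxA -mulmxBl.
  rewrite -(map_iter_mulmx _ _ sX); congr (_ *m _); apply/rowP => j; rewrite !mxE.
  by rewrite iter_additiveB [in X in X - _]iterSr sx.
rewrite telescope_sumr // opprB /G uL mul0mx subr0 expr0.
by rewrite [LHS]mulmx1; apply/rowP => j; rewrite mxE.
Qed.

End SyntheticDivision.

(** * The Koszul resolution of a semigroup ring over its Apery basis *)

Section AperyResolution.

Local Open Scope ring_scope.

(* K[S] is free over K[x_0], x_0 = t^m with m = N + 2: a basis is given by the
   powers t^(a j), where a j is the least element of S congruent to j modulo m. *)
Variables (K : fieldType) (N : nat) (g : 'I_N.+1 -> nat) (a : 'I_N.+2 -> nat).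
Hypothesis g0 : g ord0 = N.+2.
Hypothesis a0 : a ord0 = 0%N.
Hypothesis a_mod : forall j, a j = j %[mod N.+2].
Hypothesis a_le : forall i (j : 'I_N.+2), (a (inZp (g i + j)) <= g i + a j)%N.

Local Notation Q := {mpoly K[N.+1]}.
Local Notation phi := (mmap (@polyC K) (fun j : 'I_N.+1 => 'X^(g j))).

(** Multiplication by t^d, for d in S, in the Apery basis: [d + a j] is in the class of [d + j], and
    its excess over the Apery element there is absorbed by a power of x_0 = t^m. *)
Definition apery_mx (d : nat) : 'M[Q]_N.+2 :=
  \matrix_(j, l) if l == inZp (d + j)
                 then 'X_ord0 ^+ ((d + a j - a l) %/ N.+2) else 0.

Definition apery_op (i : 'I_N) : 'M[Q]_N.+2 :=
  ('X_(lift ord0 i))%:M - apery_mx (g (lift ord0 i)).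

Lemma apery_div i (j : 'I_N.+2) :
  ((g i + a j - a (inZp (g i + j))) %/ N.+2 * N.+2 + a (inZp (g i + j))
   = g i + a j)%N.
Proof.
rewrite divnK ?subnK ?a_le // -eqn_mod_dvd ?a_le //.
by rewrite a_mod /= modn_mod -modnDmr a_mod modnDmr.
Qed.

Lemma apery_mxM i j : apery_mx (g i) *m apery_mx (g j) = apery_mx (g i + g j).
Proof.
apply/matrixP => s b; rewrite !mxE; pose l : 'I_N.+2 := inZp (g i + s).
rewrite (bigD1 l) //= big1 ?addr0 => [|l' l'l]; last first.
  by rewrite mxE (negPf l'l) mul0r.
rewrite !mxE eqxx.
have -> : inZp (g i + g j + s) = inZp (g j + l) :> 'I_N.+2.
  by apply/val_inj; rewrite /= modnDmr addnCA addnA.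
case: eqP => [->|_]; last by rewrite mulr0.
rewrite -exprD; congr (_ ^+ _).
have := apery_div i s; rewrite -/l; have := apery_div j l.
move: l => l; set c1 := (_ %/ _)%N; set c2 := (_ %/ _)%N => E1 E2.
have -> : (g i + g j + a s - a (inZp (g j + l)) = (c2 + c1) * N.+2)%N by lia.
by rewrite mulnK.
Qed.

Lemma apery_op_comm i j : apery_op i *m apery_op j = apery_op j *m apery_op i.
Proof.
have scalC x (A : 'M[Q]_N.+2) : GRing.comm A x%:M.
  by rewrite /GRing.comm -mulmxE scalar_mxC.
have mxC : GRing.comm (apery_mx (g (lift ord0 i))) (apery_mx (g (lift ord0 j))).
  by rewrite /GRing.comm -mulmxE !apery_mxM addnC.
suff : GRing.comm (apery_op i) (apery_op j) by [].
apply: commrB (scalC _ _) (commr_sym _).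
by apply: commrB (scalC _ _) (commr_sym mxC).
Qed.

Lemma mdrop_apery_mx k d i j y :
  mdrop (lift ord0 k) (y * apery_mx d i j)
  = mdrop (lift ord0 k) y * apery_mx d i j.
Proof.
rewrite mxE; case: ifP => _; last by rewrite !mulr0 raddf0.
elim: (_ %/ _)%N y => [|n IH] y; first by rewrite expr0 !mulr1.
by rewrite exprSr !mulrA mdropMX ?IH // neq_lift.
Qed.

Lemma apery_op_retract (k : 'I_N) (z : {set 'I_N} -> 'rV[Q]_N.+2) :
  exists h : {additive 'rV[Q]_N.+2 -> 'rV[Q]_N.+2},
    (forall i u, i != k -> h (u *m apery_op i) = h u *m apery_op i)
    /\ (forall S, h (z S *m apery_op k) = z S).
Proof.
pose X := apery_mx (g (lift ord0 k)).
(* [L] bounds the sizes of all entries of all [z S], so [L] drops kill each of them. *)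
pose L := \max_(x : {set 'I_N} * 'I_N.+2) msize (z x.1 0%R x.2).
exists (mx_div (mdrop (lift ord0 k)) X L); split=> [i u ik|S].
  apply: mx_divM => [j l y|].
    rewrite [apery_op i j l]mxE [_%:M j l]mxE.
    rewrite [X in _ + X]mxE.
    by rewrite !mulrBr raddfB /= mdrop_apery_mx !mulrnAr raddfMn /= mdropMX.
  rewrite /apery_op mulmxBl mulmxBr mul_scalar_mx mul_mx_scalar !apery_mxM.
  by rewrite addnC.
apply: (mx_divK (x := 'X_(lift ord0 k))) => [y|i j y|].
- by rewrite /= [_ * y]mulrC mdropXK.
- exact: mdrop_apery_mx.
apply/rowP => j; rewrite !mxE mdrop_nilpotent //.
exact: (leq_bigmax (S, j)).
Qed.

Definition apery_aug (v : 'rV[Q]_N.+2) : {poly K} :=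
  \sum_j phi (v 0 j) * 'X^(a j).

Lemma phiX i : phi 'X_i = 'X^(g i).
Proof. by rewrite mmapX mmap1U. Qed.

Lemma apery_aug_mx i j :
  \sum_l phi (apery_mx (g i) j l) * 'X^(a l) = 'X^(g i + a j).
Proof.
rewrite (bigD1 (inZp (g i + j))) //= big1 ?addr0 => [|l lj]; last first.
  by rewrite mxE (negPf lj) rmorph0 mul0r.
by rewrite mxE eqxx rmorphXn /= phiX g0 -exprM -exprD mulnC apery_div.
Qed.

Lemma apery_aug_op u i : apery_aug (u *m apery_op i) = 0.
Proof.
have E l : phi ((u *m apery_op i) 0 l) * 'X^(a l)
    = 'X^(g (lift ord0 i)) * phi (u 0 l) * 'X^(a l)
      - \sum_j phi (u 0 j)
          * (phi (apery_mx (g (lift ord0 i)) j l) * 'X^(a l)).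
  rewrite mulmxBr mul_mx_scalar mxE [X in X + _]mxE [X in _ + X]mxE.
  rewrite [X in _ - X]mxE rmorphB rmorphM /= phiX mulrBl rmorph_sum mulr_suml.
  by congr (_ - _); apply: eq_bigr => j _; rewrite rmorphM mulrA.
rewrite /apery_aug (eq_bigr _ (fun l _ => E l)) sumrB exchange_big -sumrB.
rewrite big1 // => j _.
by rewrite -mulr_sumr apery_aug_mx exprD mulrCA mulrA subrr.
Qed.

Definition poly_x0 (P : {poly K}) : Q := (map_poly (@mpolyC N.+1 K) P).['X_ord0].

Lemma phi_poly_x0 P : phi (poly_x0 P) = P \Po 'X^(N.+2).
Proof.
rewrite /poly_x0 -horner_map /= phiX g0 -map_poly_comp.
by congr (_.[_]); apply: eq_map_poly => c /=; rewrite mmapC.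
Qed.

(** Modulo the operators, x_i acts as X_i, whose entries lie in K[x_0]. So every vector reduces to
    one over K[x_0], where the kernel of [apery_aug] is visible. *)
Definition has_normal_form (v : 'rV[Q]_N.+2) : Prop :=
  exists (u : 'I_N -> 'rV[Q]_N.+2) (P : 'I_N.+2 -> {poly K}),
    v = \sum_i u i *m apery_op i + \row_j poly_x0 (P j).

Lemma normal_form_add v v' :
  has_normal_form v -> has_normal_form v' -> has_normal_form (v + v').
Proof.
case=> [u [P ->]] [u' [P' ->]]; exists (fun i => u i + u' i), (fun j => P j + P' j).
rewrite addrACA -big_split; congr (_ + _).
  by apply: eq_bigr => i _; rewrite mulmxDl.
by apply/rowP => j; rewrite !mxE /poly_x0 rmorphD hornerD.
Qed.

Lemma normal_form_x0 v : has_normal_form v -> has_normal_form ('X_ord0 *: v).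
Proof.
case=> [u [P ->]]; exists (fun i => 'X_ord0 *: u i), (fun j => P j * 'X).
rewrite scalerDr scaler_sumr; congr (_ + _).
  by apply: eq_bigr => i _; rewrite scalemxAl.
apply/rowP => j; rewrite !mxE /poly_x0 rmorphM /= map_polyX.
by rewrite hornerMX mulrC.
Qed.

Lemma normal_formC c v : has_normal_form v -> has_normal_form (c%:MP *: v).
Proof.
case=> [u [P ->]]; exists (fun i => c%:MP *: u i), (fun j => c *: P j).
rewrite scalerDr scaler_sumr; congr (_ + _).
  by apply: eq_bigr => i _; rewrite scalemxAl.
by apply/rowP => j; rewrite !mxE /poly_x0 map_polyZ hornerZ.
Qed.

Lemma normal_form_xi (i : 'I_N) v :
  has_normal_form v -> has_normal_form ('X_(lift ord0 i) *: v).
Proof.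
case=> [u [P ->]]; set r := \row__ _; set x := 'X__.
pose d := g (lift ord0 i).
(* Since x_i r = r (x_i - X_i) + r X_i, the vector [r] joins the coefficient of operator [i], and r
   X_i is again over K[x_0]. *)
exists (fun i' => x *: u i' + (if i' == i then r else 0)).
exists (fun l => \sum_(j < N.+2) if l == inZp (d + j)
                 then P j * 'X^((d + a j - a l) %/ N.+2) else 0).
under [X in _ = X + _]eq_bigr do rewrite mulmxDl.
rewrite big_split /= scalerDr scaler_sumr -addrA; congr (_ + _).
  by apply: eq_bigr => i' _; rewrite scalemxAl.
rewrite (bigD1 i) //= eqxx big1 ?addr0 => [|i' /negPf ->]; last first.
  by rewrite mul0mx.
rewrite mulmxBr mul_mx_scalar -[LHS]addr0 -addrA; congr (_ + _).
apply/esym/eqP; rewrite addrC subr_eq0; apply/eqP/rowP => l; rewrite !mxE.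
rewrite /poly_x0 rmorph_sum horner_sum; apply: eq_bigr => j _; rewrite !mxE.
case: ifP => _; last by rewrite rmorph0 horner0 mulr0.
by rewrite rmorphM /= map_polyXn hornerM hornerXn.
Qed.

Lemma normal_form_scale (q : Q) v : has_normal_form v -> has_normal_form (q *: v).
Proof.
move=> nfv; have nf0 : has_normal_form 0.
  by have := normal_formC 0 nfv; rewrite mpolyC0 scale0r.
(* Quantifying over all [v] makes the property multiplicative in [q]. *)
pose stable (q : Q) := forall v, has_normal_form v -> has_normal_form (q *: v).
have stableM q1 q2 : stable q1 -> stable q2 -> stable (q1 * q2).
  by move=> s1 s2 w nfw; rewrite -scalerA; apply/s1/s2.
have stableX i : stable 'X_i.
  by move=> w nfw; case: (unliftP ord0 i) => [j|] ->;
     [apply: normal_form_xi | apply: normal_form_x0].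
suff : stable q by apply.
rewrite [q]mpolyE; elim/big_ind: _ => [|q1 q2 s1 s2|u _].
- by move=> w _; rewrite scale0r.
- by move=> w nfw; rewrite scalerDl; apply: normal_form_add; [apply: s1|apply: s2].
rewrite -mul_mpolyC; apply: (stableM _ _); first by move=> w; apply: normal_formC.
rewrite mpolyXE_id; apply: big_ind => [|q1 q2|i _].
- by move=> w; rewrite scale1r.
- exact: stableM.
elim: (u i : nat) => [|n IH]; first by move=> w; rewrite expr0 scale1r.
by rewrite exprS; apply: stableM.
Qed.

Lemma normal_formP v : has_normal_form v.
Proof.
rewrite [v]row_sum_delta; elim/big_ind: _ => [||j _].
- exists (fun=> 0), (fun=> 0); rewrite big1 ?add0r => [|i _]; last exact: mul0mx.
  by apply/rowP => j; rewrite !mxE /poly_x0 rmorph0 horner0.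
- exact: normal_form_add.
apply: normal_form_scale; exists (fun=> 0), (fun l => (l == j)%:R).
rewrite big1 ?add0r => [|i _]; last exact: mul0mx.
apply/rowP => l; rewrite !mxE eqxx /poly_x0 rmorph_nat /=.
by case: (l == j); rewrite ?horner0 // -polyC1 hornerC.
Qed.

(** On a normal form the augmentation is the sum of the P_j(t^m) t^(a j). Their exponents lie in
    distinct classes modulo m, so nothing cancels and all [P j] vanish. *)
Lemma apery_aug_eq0 v :
  apery_aug v = 0 <-> exists u : 'I_N -> 'rV_N.+2, v = \sum_i u i *m apery_op i.
Proof.
have augD x y : apery_aug (x + y) = apery_aug x + apery_aug y.
  by rewrite -big_split; apply: eq_bigr => j _; rewrite mxE rmorphD mulrDl.
have aug_sum u : apery_aug (\sum_i u i *m apery_op i) = 0.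
  elim/big_ind: _ => [|x y x0 y0|i _]; last exact: apery_aug_op.
    by rewrite /apery_aug big1 // => j _; rewrite mxE rmorph0 mul0r.
  by rewrite augD x0 y0 addr0.
split=> [|[u ->]]; last exact: aug_sum.
have [u [P ->]] := normal_formP v; rewrite augD aug_sum add0r => augP.
exists u; rewrite -[RHS]addr0; congr (_ + _); apply/rowP => j; rewrite !mxE.
suff -> : P j = 0 by rewrite /poly_x0 rmorph0 horner0.
apply/polyP => n; rewrite coef0.
have /polyP/(_ (n * N.+2 + a j)%N) := augP; rewrite coef0 coef_sum (bigD1 j) //=.
rewrite mxE phi_poly_x0 coefMXn ltnNge leq_addl /= addnK coef_comp_poly_Xn //.
rewrite dvdn_mull // mulnK // big1 ?addr0 // => l lj.
rewrite mxE phi_poly_x0 coefMXn; case: ltnP => // le_l.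
rewrite coef_comp_poly_Xn //; case: ifP => //; rewrite -eqn_mod_dvd // modnMDl.
rewrite !a_mod !modn_small // => /eqP/val_inj jl.
by rewrite jl eqxx in lj.
Qed.

Lemma apery_resolution : (forall j, exists e : Q, phi e = 'X^(a j)) ->
  is_free_resolution (toric_ideal K g) (koszul apery_op).
Proof.
case/fin_all_exists => e eP; exists (\col_c e (enum_val c).2).
have phi_e v : phi ((v *m (\col_c e (enum_val c).2)) 0 0)
    = apery_aug (koszul_unpack (Y := apery_op) (d := 0) v set0).
  rewrite mxE rmorph_sum /apery_aug.
  under [RHS]eq_bigr do rewrite mxE rmorph_sum mulr_suml /=.
  rewrite exchange_big; apply: eq_bigr => c _; rewrite mxE rmorphM /= eP.
  have : enum_val c \in koszul_cell 0 by apply: enum_valP.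
  case: (enum_val c) => S j; rewrite unfold_in /= cards_eq0 => /eqP ->.
  rewrite (bigD1 j) //= eqxx big1 ?addr0 // => l lj.
  by rewrite xpair_eqE eqxx eq_sym (negPf lj) rmorph0 mul0r.
split=> [q|v|d v]; last first.
- exact: (koszul_resolves apery_op_comm apery_op_retract).
- rewrite koszul_image0 -apery_aug_eq0 -phi_e; split; exact.
(* As [a ord0 = 0], the multiple by [q] of the basis vector at [ord0] maps to the class of [q]. *)
exists (koszul_pack apery_op 0 (fun=> q *: delta_mx 0 ord0)).
rewrite /toric_ideal rmorphB /= phi_e.
have -> : koszul_unpack (koszul_pack apery_op 0 (fun=> q *: delta_mx 0 ord0)) set0
    = q *: delta_mx 0 ord0.
  by apply: (koszul_pack_inj (koszul_unpackK _)); apply: cards0.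
rewrite /apery_aug (bigD1 ord0) //= big1 => [|j j0]; last first.
  by rewrite !mxE (negPf j0) mulr0 rmorph0 mul0r.
by rewrite !mxE !eqxx a0 !mulr1 addr0 subrr.
Qed.

(** At the origin x_i vanishes, and a power of x_0 survives only with exponent 0, that is, when the
    product is itself an Apery element. *)
Lemma apery_op_at0 i j l :
  map_mx (meval (fun=> 0)) (apery_op i) j l
  = (-1) *+ (a l == g (lift ord0 i) + a j)%N.
Proof.
rewrite !mxE mevalB mevalMn mevalXU mul0rn sub0r mulNrn; congr (- _).
have := apery_div (lift ord0 i) j.
case: eqP => [->|neq_l _].
  move: (_ %/ _)%N => c <-; rewrite rmorphXn /= mevalXU expr0n.
  have E x : (x == c * N.+2 + x)%N = (c == 0%N).
    by rewrite -{1}[x]add0n eqn_add2r eq_sym muln_eq0 orbF.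
  by rewrite E.
rewrite meval0; case: eqP => // al; case: neq_l; apply/val_inj => /=.
by rewrite -modnDmr -a_mod modnDmr -al a_mod modn_small.
Qed.

End AperyResolution.

Lemma dif_at0_koszul (K : fieldType) (k N p : nat)
    (Y : 'I_N -> 'M[{mpoly K[k]}]_p) (d : nat) :
  dif_at0 (koszul Y) d
  = dif (koszul (fun i => map_mx (meval (fun=> 0%R)) (Y i))) d.
Proof.
apply/matrixP => r c; rewrite !mxE /koszul_coef rmorph_sum; apply: eq_bigr => i _.
by rewrite rmorphM rmorphXn rmorphN1 mxE.
Qed.

(** * The Apery set of the semigroup and the resulting matching of variables *)

Section GammaApery.

Variables (K : fieldType) (N n : nat).
Hypothesis N_gt0 : 0 < N.
Hypothesis n_gt0 : 0 < n.
Hypothesis n_lt : n < N.+2.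

Local Notation g := (Gamma_gen N.+2 n).

(** The least elements of S by class. The class of [n] lacks its generator and starts at 2m + n; for
    [n = 1] even 2m + 1 = m + (m + 1) is missing, and 3m + 1 takes over. *)
Definition Gamma_apery (j : 'I_N.+2) : nat :=
  if j == 0 :> nat then 0
  else if j == n :> nat then (2 + (n == 1)) * N.+2 + n
  else N.+2 + j.

Lemma Gamma_aperyP (j : 'I_N.+2) :
  [\/ j = 0 :> nat /\ Gamma_apery j = 0,
      [/\ j = n :> nat, n = 1 & Gamma_apery j = 3 * N.+2 + n],
      [/\ j = n :> nat, n <> 1 & Gamma_apery j = 2 * N.+2 + n]
    | [/\ j <> 0 :> nat, j <> n :> nat & Gamma_apery j = N.+2 + j]].
Proof.
rewrite /Gamma_apery; case: eqP => [j0|j0]; first by constructor 1.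
case: eqP => [jn|jn]; last by constructor 4.
by case: (n =P 1) => n1; [constructor 2 | constructor 3].
Qed.

Lemma Gamma_gen_bounds (i : 'I_N.+1) :
  exists b, [/\ g i = N.+2 + b, b = (n <= i) + i, b < N.+2 & b <> n].
Proof.
exists (bump n i); rewrite /Gamma_gen; split=> //.
  by rewrite /bump; have := ltn_ord i; lia.
by rewrite /bump; lia.
Qed.

Lemma Gamma_gen_surj b : b < N.+2 -> b <> n ->
  exists i : 'I_N.+1, g i = N.+2 + b.
Proof. by move=> ltb neqb; apply/(Gamma_genP (N.+2 + b) n_lt); lia. Qed.

Lemma Gamma_gen0 : g ord0 = N.+2.
Proof. by have [b [-> -> _ _]] := Gamma_gen_bounds ord0; rewrite leqNgt n_gt0 addn0. Qed.

Lemma Gamma_apery0 : Gamma_apery ord0 = 0.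
Proof. by []. Qed.

Lemma Gamma_apery_mod j : Gamma_apery j = j %[mod N.+2].
Proof.
rewrite /Gamma_apery; case: eqP => [-> //|_]; case: eqP => [->|_].
  by rewrite modnMDl.
by rewrite modnDl.
Qed.

Lemma Gamma_apery_le (i : 'I_N.+1) (j : 'I_N.+2) :
  Gamma_apery (inZp (g i + j)) <= g i + Gamma_apery j.
Proof.
have [b [-> _ ltb neqb]] := Gamma_gen_bounds i; have ltj := ltn_ord j.
set l := inZp _.
have lE : l = (if b + j < N.+2 then b + j else b + j - N.+2) :> nat.
  rewrite /= -addnA modnDl; case: ltnP => le_m; first by rewrite modn_small.
  by rewrite -{1}(subnK le_m) modnDr modn_small //; lia.
move: lE; case: ltnP => bj;
  by case: (Gamma_aperyP l) => -[]; case: (Gamma_aperyP j) => -[]; lia.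
Qed.

Lemma Gamma_apery_monomial (j : 'I_N.+2) : exists e : {mpoly K[N.+1]},
  mmap (@polyC K) (fun i => 'X^(g i))%R e = ('X^(Gamma_apery j))%R.
Proof.
have sum2 b b' : b < N.+2 -> b <> n -> b' < N.+2 -> b' <> n ->
    exists e : {mpoly K[N.+1]},
      mmap (@polyC K) (fun i => 'X^(g i))%R e = ('X^(N.+2 + b + (N.+2 + b')))%R.
  move=> ltb nb ltb' nb'.
  have [i <-] := Gamma_gen_surj ltb nb; have [i' <-] := Gamma_gen_surj ltb' nb'.
  by exists ('X_i * 'X_i')%R; rewrite rmorphM /= !phiX exprD.
rewrite /Gamma_apery; case: eqP => [_|j0]; first by exists 1%R; rewrite rmorph1.
case: eqP => [_|jn].
  case: (n =P 1) => [n1|n1].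
    (* 3m + 1 = (m + 2) + (2m - 1). *)
    have [||||e eP] := sum2 2 N.+1; try lia.
    by exists e; rewrite eP; congr ('X^_)%R; lia.
  (* 2m + n = (m + 1) + (m + n - 1), where [n <> 1] makes m + 1 a generator. *)
  have [||||e eP] := sum2 1 n.-1; try lia.
  by exists e; rewrite eP; congr ('X^_)%R; lia.
have [i <-] := Gamma_gen_surj (ltn_ord j) jn.
by exists 'X_i%R; rewrite phiX.
Qed.

Definition Gamma_complex : free_complex {mpoly K[N.+1]} :=
  koszul (apery_op K g Gamma_apery).

Lemma Gamma_resolution : is_free_resolution (toric_ideal K g) Gamma_complex.
Proof.
apply: apery_resolution.
- exact: Gamma_gen0.
- exact: Gamma_apery0.
- exact: Gamma_apery_mod.
- exact: Gamma_apery_le.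
- exact: Gamma_apery_monomial.
Qed.

(** The products that equal the Apery element of class [n]; any other product of two variables is
    divisible by x_0 in K[S] and vanishes modulo t^m. *)
Definition Gamma_pair : rel 'I_N := fun i i' =>
  g (lift ord0 i) + g (lift ord0 i') == (2 + (n == 1)) * N.+2 + n.

(** Write the generators as m + b. For [n >= 2] pairs satisfy b + b' = n, covering 0 < b < n; for
    [n = 1] they satisfy b + b' = m + 1, covering all 2 <= b < m. *)
Lemma card_Gamma_paired : #|paired Gamma_pair| = if n == 1 then N else n.-1.
Proof.
have pairE (i : 'I_N) : (i \in paired Gamma_pair)
    = (i < if n == 1 then N else n.-1).
  rewrite inE; have lti := ltn_ord i.
  have [b [gi bE _ _]] := Gamma_gen_bounds (lift ord0 i).
  rewrite lift0 in bE.
  apply/existsP/idP => [[i']|lt_i].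
    have [b' [gi' b'E _ _]] := Gamma_gen_bounds (lift ord0 i').
    rewrite lift0 in b'E; rewrite /Gamma_pair gi gi'.
    by case: (n =P 1) => n1 /eqP; lia.
  (* The index of the partner: [i] stands for b = i + 2 if [n = 1], and for b = i + 1 if b < n. *)
  have lti' : (if n == 1 then N.-1 - i else n - i - 2) < N.
    by case: (n =P 1) lt_i => n1; lia.
  exists (Ordinal lti').
  have [b' [gi' b'E _ _]] := Gamma_gen_bounds (lift ord0 (Ordinal lti')).
  rewrite lift0 /= in b'E; rewrite /Gamma_pair gi gi'; apply/eqP.
  by case: (n =P 1) lt_i b'E => n1; lia.
rewrite (eq_card (B := [set i : 'I_N | i < if n == 1 then N else n.-1])).
  rewrite cardsE -sum1_card -(big_ord_widen _ (fun=> 1)) ?sum_nat_const ?card_ord ?muln1 //.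
  by case: (n =P 1); lia.
by move=> i; rewrite pairE inE.
Qed.

Lemma rank_Gamma d :
  (\rank (dif_at0 Gamma_complex d) + (if #|paired Gamma_pair| <= d
     then 'C(N - #|paired Gamma_pair|, d - #|paired Gamma_pair|) else 0)
   = 'C(N, d.+1) + 'C(N, d))%N.
Proof.
rewrite dif_at0_koszul -(card_pivots Gamma_pair); congr (_ + _).
pose eps (i : 'I_N) : 'I_N.+2 := inZp (g (lift ord0 i)).
have epsE i : eps i = (n <= i.+1) + i.+1 :> nat.
  have [b [gi bE ltb _]] := Gamma_gen_bounds (lift ord0 i).
  by rewrite /= gi modnDl modn_small // bE lift0.
have aeps i : Gamma_apery (eps i) = g (lift ord0 i).
  have [b [gi bE ltb neqb]] := Gamma_gen_bounds (lift ord0 i).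
  rewrite lift0 in bE; have := epsE i; rewrite gi.
  by case: (Gamma_aperyP (eps i)) => -[]; lia.
(* The factor is -1 because x_i - X_i becomes -X_i at the origin; [o] and [w] are the classes 0 and
   [n]. *)
apply: (@rank_koszul _ _ _ _ (-1)%R ord0 (Ordinal n_lt) eps _ (Ordinal N_gt0)).
- by rewrite oppr_eq0 oner_eq0.
- move=> j; case: (j =P 0 :> nat) => [j0|j0].
    by constructor 1; apply: val_inj.
  case: (j =P n :> nat) => [jn|jn]; first by constructor 2; apply: val_inj.
  constructor 3; have [i gi] := Gamma_gen_surj (ltn_ord j) jn.
  case: (unliftP ord0 i) gi => [i' ->|->] gi; last first.
    by rewrite Gamma_gen0 in gi; lia.
  by exists i'; apply: val_inj; rewrite /= gi modnDl modn_small.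
- by move=> i i' /(congr1 (@nat_of_ord _)); rewrite !epsE => ?; apply: val_inj => /=; lia.
- by move=> i; rewrite -(inj_eq (@ord_inj _)) epsE /=; lia.
- move=> i i' l; rewrite /Gamma_pair => /eqP <- /eqP /addIn.
  have [b [-> bE _ _]] := Gamma_gen_bounds (lift ord0 i).
  have [b' [-> b'E _ _]] := Gamma_gen_bounds (lift ord0 i').
  by rewrite !lift0 in bE b'E => ?; apply: val_inj => /=; lia.
- move=> i j; rewrite apery_op_at0 ?Gamma_gen0 //; last first.
  + exact: Gamma_apery_le.
  + exact: Gamma_apery_mod.
  rewrite Gamma_apery0 addn0 -(inj_eq (@ord_inj _)) epsE.
  have [b [-> bE ltb neqb]] := Gamma_gen_bounds (lift ord0 i).
  rewrite lift0 in bE; congr (_ *+ nat_of_bool _)%R.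
  by apply/eqP/eqP; case: (Gamma_aperyP j) => -[]; lia.
- move=> i i' j; rewrite apery_op_at0 ?Gamma_gen0 //; last first.
  + exact: Gamma_apery_le.
  + exact: Gamma_apery_mod.
  rewrite aeps -val_eqE /= /Gamma_pair; congr (_ *+ nat_of_bool _)%R.
  have [b [-> bE ltb neqb]] := Gamma_gen_bounds (lift ord0 i).
  have [b' [-> b'E ltb' neqb']] := Gamma_gen_bounds (lift ord0 i').
  have ltj := ltn_ord j.
  by apply/eqP/andP; case: (n =P 1) => n1; case: (Gamma_aperyP j) => -[]; lia.
move=> i j; rewrite apery_op_at0 ?Gamma_gen0 //; last first.
  + exact: Gamma_apery_le.
  + exact: Gamma_apery_mod.
rewrite (_ : (_ == _) = false) ?mulr0n //; apply/eqP.
have [b [-> bE ltb neqb]] := Gamma_gen_bounds (lift ord0 i).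
have ltj := ltn_ord j.
by case: (Gamma_aperyP (Ordinal n_lt)) => -[] /=;
   case: (Gamma_aperyP j) => -[]; lia.
Qed.

(** Rank-nullity with the ranks of the two adjacent differentials, written as a sum so that no
    subtraction truncates; [r] counts the paired variables. *)
Lemma betti_Gamma d :
  let r := if n == 1 then N else n.-1 in
  let c e := if r <= e then 'C(N - r, e - r) else 0 in
  betti (toric_ideal K g) d.+1 + ('C(N, d) + 2 * 'C(N, d.+1) + 'C(N, d.+2))
  = 'C(N, d.+1) * N.+2 + (c d + c d.+1).
Proof.
move=> r c; rewrite (betti_resolution _ _ _ Gamma_resolution); first last.
- by move=> p q; rewrite /toric_ideal rmorphM => /= ->; rewrite mulr0.
- by move=> p q; rewrite /toric_ideal rmorphD => /= -> ->; rewrite addr0.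
have := rank_Gamma d; have := rank_Gamma d.+1.
rewrite card_Gamma_paired -/r -/(c d) -/(c d.+1) /dim_homology_at0 mxrank_ker.
have rkE : rk Gamma_complex d.+1 = 'C(N, d.+1) * N.+2 by apply: rk_koszul.
(* This bound makes the natural subtractions in the homology dimension exact. *)
have : \rank (dif_at0 Gamma_complex d.+1) + \rank (dif_at0 Gamma_complex d)
       <= rk Gamma_complex d.+1.
  apply: mulmx0_rank_max.
  by rewrite -map_mxM (resolution_dd0 _ Gamma_resolution) map_mx0.
move: (\rank (dif_at0 _ d)) (\rank (dif_at0 _ d.+1)) (c d) (c d.+1).
rewrite rkE; lia.
Qed.

End GammaApery.

(** * Comparison of the Betti numbers by Pascal's rule *)

Theorem corollary3p9 (K : fieldType) (m n : nat) (le2n : 2 <= n) (ltnm : n < m) :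
  (forall d : nat, 1 <= d <= m - 3 ->
     betti (toric_ideal K (Gamma_gen m n)) d
     = betti (toric_ideal K (Gamma_gen m 1)) d
       + (if n <= d.+1 then 'C(m - n, d.+1 - n) else 0))
  /\ betti (toric_ideal K (Gamma_gen m n)) (m - 2) = m - n.
Proof.
case: m ltnm => [|[|N]] ltnm; [lia | lia |].
have N_gt0 : 0 < N by lia.
(* Pascal's rule for N - (n - 1) = m - n - 1; at [d.+2 = n] only the second term survives, and both
   sides are 1. *)
have cE d : (if n.-1 <= d then 'C(N - n.-1, d - n.-1) else 0)
      + (if n.-1 <= d.+1 then 'C(N - n.-1, d.+1 - n.-1) else 0)
    = if n <= d.+2 then 'C(N.+2 - n, d.+2 - n) else 0.
  have -> : N.+2 - n = (N - n.-1).+1 by lia.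
  case: (ltngtP d.+2 n) => [lt_dn|lt_nd|eq_dn].
  - by rewrite !ifF //; lia.
  - rewrite !ifT; try lia.
    have -> : d.+2 - n = (d - n.-1).+1 by lia.
    by rewrite subSn ?binS; lia.
  - rewrite ifF ?ifT; try lia.
    have -> : d.+1 - n.-1 = 0 by lia.
    by rewrite eq_dn subnn !bin0.
have n1 : (n == 1) = false by lia.
split=> [[//|d] /andP[_ le_d]|].
  have := betti_Gamma K N_gt0 (ltnW le2n) ltnm d.
  have := betti_Gamma K N_gt0 (ltnSn 0) (isT : 1 < N.+2) d.
  (* For [n = 1] all N variables are paired, and [d.+1 < N], so the corrections for S_1 vanish. *)
  rewrite n1 /= cE [N <= d]leqNgt [N <= d.+1]leqNgt.
  have -> : d < N by lia.
  have -> : d.+1 < N by lia.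
  by rewrite /=; lia.
(* The top degree is N = [d.+1]. There the Pascal sum is 'C(m - n, m - n - 1) = m - n, and the other
   terms cancel since N + 2 = m. *)
case: N N_gt0 ltnm cE => // d _ ltnm cE.
have := betti_Gamma K (ltn0Sn d) (ltnW le2n) ltnm d.
rewrite n1 /= cE binn binSn (bin_small (ltnSn _)) !subSS subn0.
rewrite ifT; last lia.
have -> : d.+3 - n = (d.+2 - n).+1 by lia.
by rewrite binSn; lia.
Qed.
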